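(* Let $\mathfrak g$ be of type $B_3^{(1)}$, $I=\{0,1,2,3\}$, and let $M=\prod_{i\in I}\prod_{k\ge0}Y_{i,k}^{y_{i,k}}\mathbf 1\in\mathcal M(\infty)$. Then $$D(M)=\sum_{m\ge0}\ \sum_{k=0}^{m}\left[\left(2\left\lfloor\tfrac{k}{2}\right\rfloor-\left\lfloor\tfrac{k-1}{2}\right\rfloor\right)y_{0,m-k}+\left\lfloor\tfrac{k+1}{2}\right\rfloor y_{1,m-k}+k\,y_{2,m-k}+\left\lfloor\tfrac{k}{2}\right\rfloor y_{3,m-k}\right].$$
   Context: Type $B_3^{(1)}$: $I=\{0,1,2,3\}$; Cartan matrix $C_{ii}=2$, $C_{02}=C_{20}=C_{12}=C_{21}=C_{23}=-1$, $C_{32}=-2$, all other entries $0$. Modified Nakajima monomials: $\widehat{\mathcal M}$ is the set of monomials $M=\prod_{i\in I}\prod_{k\ge0}Y_{i,k}^{y_{i,k}}\mathbf 1$ in formal commuting variables $Y_{i,k}$ ($i\in I$, $k\ge 0$) times an additional formal commuting variable $\mathbf 1$, where $y_{i,k}\in\mathbb Z$ and all but finitely many $y_{i,k}$ are $0$. For such $M$ and $i\in I$ put $\langle h_i,\mathrm{wt}(M)\rangle=\sum_{k\ge0}y_{i,k}$, $\varphi_i(M)=\max\{\sum_{j=0}^k y_{i,j}:k\ge0\}$, $\varepsilon_i(M)=\varphi_i(M)-\langle h_i,\mathrm{wt}(M)\rangle$, $k_f=\min\{k\ge0:\varphi_i(M)=\sum_{j=0}^k y_{i,j}\}$, $k_e=\max\{k\ge0:\varphi_i(M)=\sum_{j=0}^k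 y_{i,j}\}$ (used only when $\varepsilon_i(M)>0$). Put $A_{i,k}=Y_{i,k}Y_{i,k+1}\prod_{j\ne i}Y_{j,k+o_{j,i}}^{C_{ji}}$ with $o_{i,j}=1$ if $i<j$ and $o_{i,j}=0$ if $i>j$; that is $$A_{0,k}=Y_{0,k}Y_{0,k+1}Y_{2,k}^{-1},\quad A_{1,k}=Y_{1,k}Y_{1,k+1}Y_{2,k}^{-1},\quad A_{2,k}=Y_{2,k}Y_{2,k+1}Y_{0,k+1}^{-1}Y_{1,k+1}^{-1}Y_{3,k}^{-2},\quad A_{3,k}=Y_{3,k}Y_{3,k+1}Y_{2,k+1}^{-1}.$$ The Kashiwara operators are $\widetilde f_iM=A_{i,k_f}^{-1}M$, and $\widetilde e_iM=A_{i,k_e}M$ if $\varepsilon_i(M)>0$, $\widetilde e_iM=0$ if $\varepsilon_i(M)=0$. $\mathcal M(\infty)$ is the connected component of $\widehat{\mathcal M}$, under application of the operators $\widetilde e_i,\widetilde f_i$ ($i\in I$), containing the monomial $\mathbf 1$ (all exponents $0$). It is known that $\mathcal M(\infty)$ is isomorphic to the crystal $B(\infty)$ as a $U_q'(\mathfrak g)$-crystal, with $\mathbf 1$ corresponding to the highest weight element; in particular every element of $\mathcal M(\infty)$ is of the form $\widetilde f_{b_1}\cdots\widetilde f_{b_\ell}\mathbf 1$. The function $D$: the weight lattice is $P=\bigoplus_{i\in I}\mathbb Z\Lambda_i\oplus\mathbb Z\delta$ with $\alpha_i=\sum_{j\in I}C_{ji}\Lambda_j$ for $i\ne0$ and $\alpha_0=\sum_{j\in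 I}C_{j0}\Lambda_j+\delta$. $D:\mathcal M(\infty)\to\mathbb Z$ is the function such that $\mathrm{wt}(M)=\sum_{i\in I}\bigl(\sum_{k\ge0}y_{i,k}\bigr)\Lambda_i+D(M)\delta$ is the affine weight function making $\mathcal M(\infty)$ a $U_q(\mathfrak g)$-crystal, i.e. $\mathrm{wt}(\mathbf 1)=0$ and $\mathrm{wt}(\widetilde f_iM)=\mathrm{wt}(M)-\alpha_i$ for all $i\in I$. Equivalently, if $M=\widetilde f_{b_1}\cdots\widetilde f_{b_\ell}\mathbf 1$, then $D(M)=-|\{1\le j\le\ell:b_j=0\}|$ (independent of the chosen expression). *)

(* Defs.v *)
From Stdlib Require Import Relation_Operators ClassicalEpsilon.
From mathcomp Require Import all_boot all_order all_algebra.
From mathcomp.multinomials Require Export freeg.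

Set Implicit Arguments.
Unset Strict Implicit.
Unset Printing Implicit Defensive.

Import Order.TTheory GRing.Theory Num.Theory.
Local Open Scope ring_scope.

(* The index set {0, 1, 2, 3}; a numeral [n : idx] with n < 4 denotes the
   ordinal n through the ring structure Z/4 of 'I_4. *)
Notation idx := 'I_4.

Definition cartan (i j : idx) : int :=
  nth 0 (nth [::]
    [:: [:: 2;  0; -1;  0];
        [:: 0;  2; -1;  0];
        [:: -1; -1; 2; -1];
        [:: 0;  0; -2;  2]] i) j.

(* A monomial is given by its exponents, i.e. by an element of the free abelian
   group on the variables Y_{i,k}.  The group law is written additively: + is
   the product of Laurent monomials and 0 is the monomial 1 (all exponents 0);
   the formal factor 1 occurs exactly once in every monomial. *)
Notation monomial := {freeg (idx * nat)%type}.

Definition Y (i : idx) (k : nat) : monomial := << (i, k) >>.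

Definition y (M : monomial) (i : idx) (k : nat) : int := coeff (i, k) M.

(* All exponents y_{i,k} with k >= bound M vanish, see [y_bound]. *)
Definition bound (M : monomial) : nat := \max_(x <- dom M) x.2.+1.

(* <h_i, wt(M)> *)
Definition hwt (i : idx) (M : monomial) : int := \sum_(k < bound M) y M i k.

Definition psum (M : monomial) (i : idx) (k : nat) : int :=
  \sum_(j < k.+1) y M i j.

(* The partial sums are constant from k = bound M on, so the extrema over all
   k >= 0 are taken over k <= bound M; see [phiP], [kfP] and [keP]. *)
Definition phi (i : idx) (M : monomial) : int :=
  \big[Order.max/psum M i 0]_(k < (bound M).+1) psum M i k.

Definition eps (i : idx) (M : monomial) : int := phi i M - hwt i M.

Definition kf (i : idx) (M : monomial) : nat :=
  find (fun k => phi i M == psum M i k) (iota 0 (bound M).+1).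

Definition ke (i : idx) (M : monomial) : nat :=
  \max_(k < (bound M).+1 | phi i M == psum M i k) k.

Definition o (i j : idx) : nat := (i < j)%N.

Definition A (i : idx) (k : nat) : monomial :=
  Y i k + Y i k.+1 + \sum_(j : idx | j != i) Y j (k + o j i) *~ cartan j i.

Definition f (i : idx) (M : monomial) : monomial := M - A i (kf i M).

(* [None] stands for the element 0 outside the crystal. *)
Definition e (i : idx) (M : monomial) : option monomial :=
  if 0 < eps i M then Some (M + A i (ke i M)) else None.

Definition edge (M N : monomial) : Prop :=
  exists i : idx, N = f i M \/ e i M = Some N.

Definition in_Minf (M : monomial) : Prop :=
  clos_refl_sym_trans monomial edge 0 M.

Definition Minf : Type := {M : monomial | in_Minf M}.

Definition mon (M : Minf) : monomial := proj1_sig M.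

Definition Minf_one : Minf := exist in_Minf 0 (rst_refl monomial edge 0).

(* The weight lattice: the coordinates on the Lambda_i, then the one on delta. *)
Notation weight := ('rV[int]_4 * int)%type.

Definition Lambda (i : idx) : weight := (delta_mx 0 i, 0).

Definition delta : weight := (0, 1).

Definition alpha (i : idx) : weight :=
  \sum_(j : idx) Lambda j *~ cartan j i + (if i == 0 then delta else 0).

Definition wt (d : Minf -> int) (M : Minf) : weight :=
  \sum_(i : idx) Lambda i *~ hwt i (mon M) + delta *~ d M.

Definition is_affine_weight (d : Minf -> int) : Prop :=
  wt d Minf_one = 0 /\
  forall (i : idx) (M N : Minf), mon N = f i (mon M) -> wt d N = wt d M - alpha i.

(* At most one function satisfies [is_affine_weight], as Minf is connected, so
   the choice operator just names it. *)
Definition D : Minf -> int := epsilon (inhabits (fun=> 0)) is_affine_weight.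

(* Sum of a series of integers; convergence in the discrete group int means
   that all but finitely many terms vanish. *)
Definition sums_to (u : nat -> int) (s : int) : Prop :=
  exists n0 : nat, forall n : nat, (n0 <= n)%N -> \sum_(m < n) u m = s.

Definition floor_half (z : int) : int := (z %/ 2)%Z.

Lemma y_bound M i k : (bound M <= k)%N -> y M i k = 0.
Proof.
move=> le_k; apply: coeff_outdom; apply/negP => ik_M.
have lt_k : (k < bound M)%N.
  exact: (@leq_bigmax_seq _ _ xpredT (fun x : idx * nat => x.2.+1) _ ik_M).
by move: le_k; rewrite leqNgt lt_k.
Qed.

Lemma psum_bound M i k : (bound M <= k.+1)%N -> psum M i k = hwt i M.
Proof.
move=> le_k; rewrite /psum /hwt -(subnKC le_k) big_split_ord /=.
by rewrite [X in _ + X]big1 ?addr0 // => j _; rewrite y_bound ?leq_addr.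
Qed.

Lemma phiP M i :
  (exists k, phi i M = psum M i k) /\ (forall k, psum M i k <= phi i M).
Proof.
split=> [|k].
  rewrite /phi; elim/big_ind: _ => [|a b [k ->] [l ->]|k _]; first by exists 0%N.
    by case: leP => _; [exists l | exists k].
  by exists k.
have le_phi l : (l <= bound M)%N -> psum M i l <= phi i M.
  move=> le_l; have lt_l : (l < (bound M).+1)%N by [].
  exact: (le_bigmax _ (fun k : 'I_(bound M).+1 => psum M i k) (Ordinal lt_l)).
have [/le_phi //|lt_k] := leqP k (bound M).
rewrite psum_bound ?(leqW (ltnW lt_k)) // -(@psum_bound _ _ (bound M)) //.
exact: le_phi.
Qed.

Lemma kfP M i :
  phi i M = psum M i (kf i M) /\
  (forall k, phi i M = psum M i k -> (kf i M <= k)%N).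
Proof.
set a := fun k => phi i M == psum M i k.
have min_kf k : phi i M = psum M i k -> (kf i M <= k)%N.
  move=> Ek; have [le_k|lt_k] := leqP k (bound M); last first.
    apply: leq_trans lt_k.
    by rewrite -[X in (_ <= X)%N](size_iota 0) find_size.
  rewrite leqNgt; apply/negP => lt_kf.
  by have := before_find 0%N lt_kf; rewrite nth_iota // add0n Ek eqxx.
split=> //; have [[k Ek] _] := phiP M i.
suff ex_a : has a (iota 0 (bound M).+1).
  have := nth_find 0%N ex_a; rewrite nth_iota ?add0n; first by move/eqP.
  by rewrite -[X in (_ < X)%N](size_iota 0) -has_find.
have [le_k|lt_k] := leqP k (bound M).
  by apply/hasP; exists k; rewrite ?mem_iota // /a Ek.
apply/hasP; exists (bound M); rewrite ?mem_iota ?leqnn // /a Ek.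
by rewrite !psum_bound // leqW // ltnW.
Qed.

Lemma keP M i : 0 < eps i M ->
  phi i M = psum M i (ke i M) /\
  (forall k, phi i M = psum M i k -> (k <= ke i M)%N).
Proof.
rewrite subr_gt0 => lt_phi.
have ltk k : phi i M = psum M i k -> (k < (bound M).+1)%N.
  move=> Ek; rewrite ltnS leqNgt; apply/negP => lt_k.
  by move: lt_phi; rewrite Ek psum_bound ?ltxx // leqW // ltnW.
split=> [|k Ek]; last first.
  have Ek' : phi i M == psum M i (Ordinal (ltk k Ek)) by rewrite /= -Ek.
  exact: (@leq_bigmax_cond _ _ (fun k : 'I_(bound M).+1 => k : nat) _ Ek').
have [[k Ek] _] := phiP M i.
have [|k' /eqP Ek' Eke] := @eq_bigmax_cond _
  (fun k : 'I_(bound M).+1 => phi i M == psum M i k) (fun k => k : nat).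
  by apply/card_gt0P; exists (Ordinal (ltk k Ek)); rewrite unfold_in /= -Ek.
by rewrite /ke Eke.
Qed.

(* Main.v *)
Require Import Defs.
From Stdlib Require Import Relation_Operators ClassicalEpsilon.
From HB Require Import structures.
From mathcomp Require Import all_boot all_order all_algebra zify.

Set Implicit Arguments.
Unset Strict Implicit.
Unset Printing Implicit Defensive.

Import Order.TTheory GRing.Theory Num.Theory.
Local Open Scope ring_scope.

(** Write [dterm m M] for the m-th term of the series.  It is additive in the
    monomial M, so a Kashiwara operator changes it by its value at one of the
    [A i n], up to sign.  The coefficients [dcoef] are chosen so that this
    value is 1 for i = 0 and m = n, and 0 otherwise ([dterm_A]).  With c_j the
    generating function in z of the sequence [dcoef j], this amounts to
    [(1 + z) c_0 = 1 + c_2], [(1 + z) c_1 = c_2],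
    [(1 + z) c_2 = z (c_0 + c_1) + 2 c_3] and [(1 + z) c_3 = z c_2],
    one equation for each i, read off the exponents of [A i n].

    On an arbitrary monomial, for instance a single variable, the series may
    diverge.  But [f 0] lowers exactly one of its terms, by 1, and the other [f i]
    leave all terms unchanged ([dterm_f], [sums_to_dterm_f]).  Every edge of the
    crystal graph is an [f i] read forwards or backwards, because [e i] is a
    partial inverse of [f i] ([e_f]); this gives the induction principle [in_Minf_ind].  Starting from the
    monomial with all exponents 0, the series therefore converges on the whole
    component, and its sum obeys the recursion that characterises the
    delta-coordinate of the affine weight.

    The coordinates of the weight along the Lambda_i obey their own recursion
    automatically ([hwt_f]), so [is_affine_weight] is a condition on the
    delta-coordinate alone ([is_affine_weightP]).  Taking the sum of the series
    as this coordinate shows that an affine weight exists, so that [D] is one;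
    and by the same induction every affine weight equals the sum of the
    series ([affine_weight_sums_to]). *)

(** * Linear functionals on monomials *)

Fact y_is_zmod_morphism i k : zmod_morphism (fun M : monomial => y M i k).
Proof. by move=> M N; rewrite /y freeg.coeffB. Qed.

Lemma yB M N i k : y (M - N) i k = y M i k - y N i k.
Proof. exact: y_is_zmod_morphism. Qed.

Lemma y_Y i n j k : y (Y i n) j k = ((i == j) && (n == k))%:R.
Proof. by rewrite /y /Y freeg.coeffU mul1r -pair_eqE. Qed.

Fact psum_is_zmod_morphism i k : zmod_morphism (fun M => psum M i k).
Proof.
by move=> M N; rewrite /psum -sumrB; apply: eq_bigr => j _; rewrite yB.
Qed.

(** Additivity is a hypothesis rather than a structure on [L], because a
    functional such as [fun M => psum M i k] has no head constant on which an
    instance could be declared. *)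
Lemma zmod_morphism_A (L : monomial -> int) i n : zmod_morphism L ->
  L (A i n) = L (Y i n) + L (Y i n.+1)
              + \sum_(j | j != i) cartan j i * L (Y j (n + o j i)).
Proof.
move=> addL; pose mixL := GRing.isZmodMorphism.Build monomial int L addL.
pose aL : {additive monomial -> int} := HB.pack L mixL.
rewrite /A -[L]/(aL : _ -> _) !raddfD raddf_sum; congr (_ + _).
by apply: eq_bigr => j _; rewrite raddfMz mulrC mulrzz.
Qed.

Lemma psumB M N i k : psum (M - N) i k = psum M i k - psum N i k.
Proof. exact: psum_is_zmod_morphism. Qed.

Lemma psum_Y i n j k : psum (Y i n) j k = ((i == j) && (n <= k)%N)%:R.
Proof.
rewrite /psum; under eq_bigr do rewrite y_Y.
have [_|_] /= := eqVneq i j; last by rewrite big1.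
have [le_nk|lt_kn] := leqP n k; last first.
  by rewrite big1 // => l _; case: eqP => // Enl; have := ltn_ord l; lia.
rewrite (bigD1 (inord n)) //= inordK // eqxx big1 ?addr0 // => l.
by case: (eqVneq n l) => // -> /eqP []; rewrite inord_val.
Qed.

Lemma psum_A i n j k :
  psum (A i n) j k =
    if j == i then (n <= k)%N%:R + (n < k)%N%:R
    else cartan j i * (n + o j i <= k)%N%:R.
Proof.
rewrite (zmod_morphism_A _ _ (psum_is_zmod_morphism j k)) !psum_Y.
have [->|nji] := eqVneq j i.
  rewrite big1 ?addr0 // => l nli.
  by rewrite psum_Y (negPf nli) mulr0.
rewrite !add0r (bigD1 j) //= big1 => [|l /andP[_ nlj]].
  by rewrite psum_Y eqxx addr0.
by rewrite psum_Y (negPf nlj) mulr0.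
Qed.

(** * The Kashiwara operators *)

Lemma cartan_diag i : cartan i i = 2.
Proof. by case: i => [[|[|[|[|//]]]] ?]. Qed.

(** Multiplying by the inverse of [A j n] lowers the weight by alpha_j, whatever
    n is: the shifts of the second index are invisible to the total sums. *)
Lemma hwt_f i j M : hwt i (f j M) = hwt i M - cartan i j.
Proof.
(* beyond k, all partial sums involved have reached their final values *)
set k := maxn (maxn (bound (f j M)) (bound M)) (kf j M).+2.
have stab N : (bound N <= k)%N -> hwt i N = psum N i k.
  by move=> le_k; rewrite psum_bound // leqW.
rewrite !stab ?leq_max ?leqnn ?orbT // /f psumB psum_A.
have le_k : ((kf j M).+2 <= k)%N by rewrite leq_max leqnn orbT.
congr (_ - _); have [->|_] := eqVneq i j; first by rewrite cartan_diag; lia.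
have -> : (kf j M + o i j <= k)%N by rewrite /o; lia.
by rewrite mulr1.
Qed.

(** Multiplying M by [A i (ke i M)] raises the partial sum at [ke i M] by 1,
    leaves the earlier ones alone and raises the later ones by 2.  As [ke i M] is
    the last maximum of the partial sums of M, the later ones were at most
    [phi i M - 1], so [ke i M] becomes the first maximum, and that is where [f i]
    divides by [A i n]. *)
Lemma e_f i M N : e i M = Some N -> f i N = M.
Proof.
rewrite /e; case: ifP => // eps_gt0 [<-].
have [Ephi max_ke] := keP eps_gt0; have [_ le_phi] := phiP M i.
set N' := M + _; have psumN k : psum N' i k = psum M i k
    + ((ke i M <= k)%N%:R + (ke i M < k)%N%:R).
  by have := psumB N' (A i (ke i M)) i k; rewrite addrK psum_A eqxx; lia.
have lt_phi k : (ke i M < k)%N -> psum M i k < phi i M.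
  move=> lt_k; rewrite lt_neqAle le_phi andbT; apply/eqP => Ek.
  by have := max_ke k (esym Ek); lia.
have [EphiN min_kf] := kfP N' i; have [[k0 Ek0] le_phiN] := phiP N' i.
have EkN : phi i N' = psum N' i (ke i M).
  apply/eqP; rewrite eq_le le_phiN andbT Ek0 !psumN -Ephi leqnn ltnn.
  have := le_phi k0; case: (ltngtP (ke i M) k0) => [/lt_phi|_|_]; lia.
suff Ekf : kf i N' = ke i M by rewrite /f Ekf addrK.
apply/eqP; rewrite eqn_leq min_kf //= leqNgt; apply/negP => lt_ke.
move: EphiN; rewrite EkN !psumN -Ephi leqnn ltnn leqNgt lt_ke ltnNge ltnW //=.
have := le_phi (kf i N'); lia.
Qed.

Lemma in_Minf_f i M : in_Minf M <-> in_Minf (f i M).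
Proof.
have Mf : clos_refl_sym_trans monomial edge M (f i M).
  by apply: rst_step; exists i; left.
by split=> M_in; apply: rst_trans M_in _ => //; apply: rst_sym.
Qed.

(** The condition on P is an equivalence because the component is generated by
    paths that use both directions of the edges. *)
Lemma in_Minf_ind (P : monomial -> Prop) :
  P 0 -> (forall i M, P M <-> P (f i M)) -> forall M, in_Minf M -> P M.
Proof.
move=> P0 Pf M M_in; suff [+ _] : P 0 <-> P M by apply.
elim: M_in => {M} [M N [i [->|/e_f <-]]|M|M N _ IH|M N K _ IHM _ IHN].
- exact: Pf.
- exact: iff_sym (Pf i N).
- by [].
- exact: iff_sym.
- exact: iff_trans IHM IHN.
Qed.

(** * The series *)

Definition dcoef (j : idx) (k : nat) : int :=
  nth 0 [:: 2 * floor_half (k : int) - floor_half ((k : int) - 1);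
            floor_half ((k : int) + 1); (k : int); floor_half (k : int)] j.

Definition dterm (m : nat) (M : monomial) : int :=
  \sum_(j : idx) \sum_(k < m.+1) dcoef j k * y M j (m - k).

Fact dterm_is_zmod_morphism m : zmod_morphism (dterm m).
Proof.
move=> M N; rewrite /dterm -sumrB; apply: eq_bigr => j _.
by rewrite -sumrB; apply: eq_bigr => k _; rewrite yB mulrBr.
Qed.

Lemma dterm_Y m i n :
  dterm m (Y i n) = if (n <= m)%N then dcoef i (m - n) else 0.
Proof.
rewrite /dterm (bigD1 i) //= [X in _ + X]big1 => [|j nji]; last first.
  by rewrite big1 // => k _; rewrite y_Y eq_sym (negPf nji) mulr0.
rewrite addr0; under eq_bigr do rewrite y_Y eqxx /=.
have [le_nm|lt_mn] := leqP n m; last first.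
  by rewrite big1 // => k _; case: eqP; rewrite ?mulr0 //; lia.
have lt_m : (m - n < m.+1)%N by lia.
rewrite (bigD1 (Ordinal lt_m)) //= subKn // eqxx mulr1 big1 ?addr0 // => k.
rewrite -val_eqE /= => nk; have := ltn_ord k.
by case: eqP; rewrite ?mulr0 //; lia.
Qed.

(** The identities between floors on which the formula rests; the four cases are
    the four generating function equations above. *)
Lemma dterm_A i n m : dterm m (A i n) = ((i == 0) && (n == m))%:R.
Proof.
rewrite (zmod_morphism_A _ _ (dterm_is_zmod_morphism m)).
under eq_bigr do rewrite dterm_Y.
rewrite !dterm_Y big_mkcond !big_ord_recl big_ord0.
case: i => [[|[|[|[|//]]]] ?]; rewrite /= /cartan /o /dcoef /floor_half /=.
- do !case: ifP => ?; lia.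
- do !case: ifP => ?; lia.
- do !case: ifP => ?; lia.
- do !case: ifP => ?; lia.
Qed.

Lemma dterm_f i M m :
  dterm m (f i M) = dterm m M - ((i == 0) && (kf i M == m))%:R.
Proof. by rewrite /f dterm_is_zmod_morphism dterm_A. Qed.

Lemma sums_to_unique u s t : sums_to u s -> sums_to u t -> s = t.
Proof.
move=> [p up] [q uq].
by rewrite -(up (maxn p q)) ?leq_maxl // -(uq (maxn p q)) ?leq_maxr.
Qed.

Lemma sums_to_dterm0 : sums_to (dterm^~ 0) 0.
Proof.
exists 0%N => n _; apply: big1 => m _.
by have := dterm_is_zmod_morphism m 0 0; rewrite !subrr.
Qed.

Lemma sums_to_dterm_f i M s :
  sums_to (dterm^~ M) s <-> sums_to (dterm^~ (f i M)) (s - (i == 0)%:R).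
Proof.
have E n : (kf i M < n)%N ->
    \sum_(m < n) dterm m (f i M) = \sum_(m < n) dterm m M - (i == 0)%:R.
  move=> lt_n; under eq_bigr do rewrite dterm_f.
  rewrite sumrB; congr (_ - _); have [_|_] /= := eqVneq i 0; last by rewrite big1.
  rewrite (bigD1 (Ordinal lt_n)) //= eqxx big1 ?addr0 // => m.
  by rewrite -val_eqE /= eq_sym => /negPf ->.
split=> -[p sM]; exists (maxn p (kf i M).+1) => n;
  rewrite geq_max => /andP[le_n lt_n].
  by rewrite E // sM.
by apply: (addIr (- (i == 0)%:R)); rewrite -E // sM.
Qed.

(** * Affine weights *)

Lemma sum_Lambda (a : idx -> int) :
  \sum_(i : idx) Lambda i *~ a i = (\row_i a i, 0) :> weight.
Proof.
rewrite [LHS]surjective_pairing (raddf_sum fst) (raddf_sum snd); congr (_, _).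
  apply/rowP => j; rewrite summxE mxE (bigD1 j) //= big1 => [|i /negPf nij].
    by rewrite (raddfMz fst) /= -scaler_int !mxE !eqxx intz mulr1 addr0.
  by rewrite (raddfMz fst) /= -scaler_int !mxE eq_sym nij mulr0.
by rewrite big1 // => i _; rewrite (raddfMz snd) /= mul0rz.
Qed.

Lemma wtE d M : wt d M = (\row_i hwt i (mon M), d M).
Proof.
rewrite /wt sum_Lambda [LHS]surjective_pairing raddfD (raddfD snd) !raddfMz /=.
by rewrite mul0rz addr0 add0r intz.
Qed.

Lemma alphaE i : alpha i = (\row_j cartan j i, (i == 0)%:R).
Proof.
rewrite /alpha sum_Lambda [LHS]surjective_pairing (raddfD fst) (raddfD snd).
by case: eqP; rewrite /= addr0 add0r.
Qed.

(** The Lambda_i-coordinates of the weight recursion agree by [hwt_f], which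
    leaves the equation along delta. *)
Lemma is_affine_weightP d :
  is_affine_weight d <->
  d Minf_one = 0 /\
  forall i (M N : Minf), mon N = f i (mon M) -> d N = d M - (i == 0)%:R.
Proof.
have hwt0 i : hwt i 0 = 0.
  by rewrite /hwt big1 // => k _; rewrite /y freeg.coeff0.
split=> -[d0 df]; split.
- by have := d0; rewrite wtE => -[].
- by move=> i M N /df; rewrite !wtE alphaE => -[].
- rewrite wtE d0; congr (_, _); apply/rowP => i; rewrite !mxE; exact: hwt0.
- move=> i M N Nf; rewrite !wtE alphaE (df i M N Nf) Nf; congr (_, _).
  by apply/rowP => j; rewrite !mxE hwt_f.
Qed.

Lemma in_Minf_summable M : in_Minf M -> exists s, sums_to (dterm^~ M) s.
Proof.
elim/in_Minf_ind: M / => [|i M].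
  by exists 0; apply: sums_to_dterm0.
split=> -[s sM]; [exists (s - (i == 0)%:R)|exists (s + (i == 0)%:R)].
  exact: (iffLR (sums_to_dterm_f i M s)).
by apply: (iffRL (sums_to_dterm_f i M _)); rewrite addrK.
Qed.

(** [D] is given by a choice operator, so its defining property has to be
    realised; the witness is the sum of the series itself. *)
Lemma affine_weight_exists : exists d, is_affine_weight d.
Proof.
pose d (M : Minf) := epsilon (inhabits 0) (sums_to (dterm^~ (mon M))).
have dP M : sums_to (dterm^~ (mon M)) (d M).
  by apply: epsilon_spec; apply: in_Minf_summable; case: M.
exists d; apply/is_affine_weightP; split.
  exact: (sums_to_unique (dP Minf_one) sums_to_dterm0).
move=> i M N Nf; apply: sums_to_unique (dP N) _.
by rewrite Nf; apply: (iffLR (sums_to_dterm_f i _ _)).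
Qed.

Lemma affine_weight_sums_to d M :
  is_affine_weight d -> sums_to (dterm^~ (mon M)) (d M).
Proof.
move=> /is_affine_weightP[d0 df]; case: M => M M_in /=.
(* quantifying over the membership proof makes P a predicate on monomials *)
pose P N := forall N_in, sums_to (dterm^~ N) (d (exist in_Minf N N_in)).
suff: P M by apply.
elim/in_Minf_ind: M / M_in => [N_in|i M].
  rewrite (proof_irrelevance _ N_in (proj2_sig Minf_one)) d0.
  exact: sums_to_dterm0.
split=> PM N_in.
  have M_in : in_Minf M := iffRL (in_Minf_f i M) N_in.
  by rewrite (df i (exist _ M M_in)) //; apply: (iffLR (sums_to_dterm_f i M _)).
have fM_in : in_Minf (f i M) := iffLR (in_Minf_f i M) N_in.
apply: (iffRL (sums_to_dterm_f i M _)); rewrite -(df i _ (exist _ _ fM_in)) //.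
Qed.

Theorem theorem4p4 (M : Minf) :
  sums_to
    (fun m : nat =>
       \sum_(k < m.+1)
         ((2 * floor_half (k : int) - floor_half ((k : int) - 1)) * y (mon M) 0 (m - k)
          + floor_half ((k : int) + 1) * y (mon M) 1 (m - k)
          + (k : int) * y (mon M) 2 (m - k)
          + floor_half (k : int) * y (mon M) 3 (m - k)))
    (D M).
Proof.
have [n0 sumD] : sums_to (dterm^~ (mon M)) (D M).
  by apply: affine_weight_sums_to; apply: epsilon_spec affine_weight_exists.
exists n0 => n /sumD <-; apply: eq_bigr => m _; rewrite /dterm exchange_big.
apply: eq_bigr => k _ /=; rewrite !big_ord_recl big_ord0 /dcoef /= addr0 !addrA.
by do 3!congr (_ + _); congr (_ * y _ _ _); apply: val_inj.
Qed.
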